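(* Consider the Markov-modeled downlink with randomly delayed ARQ feedback described in the context (with $p>r$). When $N>2$, the sum capacity $C_{\mathrm{sum}}(N)$ of the downlink can be bounded as $$C_{\mathrm{sum}}(2)\le C_{\mathrm{sum}}(N)\le C_{\mathrm{sum}}^{\mathrm{genie}}(N),$$ where $C_{\mathrm{sum}}^{\mathrm{genie}}(N)$ is the sum capacity of the $N$-user genie-aided system.
   Context: Model. There are $N$ users. Time is slotted and slots are indexed in DEcreasing order $m,m-1,\ldots,1$, where $m$ is the horizon (slot $m$ is first, slot $1$ is last). The channel state of user $i$ in slot $t$ is $S_t(i)\in\{0,1\}$ ($1$ = ON, $0$ = OFF). The channels are independent across users, and each is a Markov chain with $P(S_t(i)=1\mid S_{t+1}(i)=1)=p$ and $P(S_t(i)=1\mid S_{t+1}(i)=0)=r$, with $p,r\in[0,1]$, $p>r$ and $p+(1-r)<2$. Initially $P(S_m(i)=1)=\pi_m(i)$. The stationary ON probability is $p_s=\frac{r}{1-(p-r)}$. Scheduling and feedback. In each slot $t$ the scheduler, not knowing the channel states, schedules exactly one user $a_t\in\{1,\ldots,N\}$. The scheduled user generates the ARQ feedback bit $f_t=S_t(a_t)$, which arrives, without error and stamped with its originating slot, at the end of slot $t-D(a_t,t)$ (delay $0$ means it arrives at the end of slot $t$ itself). The delays $D(i,t)$ are i.i.d. across users and time with probability mass function $P_D$ on $\{0,1,2,\ldots\}$ and independent of the channels; $D$ denotes a generic delay with this law. Beliefs. The belief $\pi_t(i)$ is the conditional probability that user $i$'s channel is ON in slot $t$ given all feedback that has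 arrived by the beginning of slot $t$. Write $T(x)=xp+(1-x)r$, $T^0(x)=x$, $T^u=T\circ T^{u-1}$. Policies and reward. A scheduling policy is a family of maps $\{\mathfrak{A}_k\}_{k\ge1}$, where $\mathfrak{A}_k$ maps all the information available to the scheduler in slot $k$ (time-stamped feedback arrived so far, equivalently the current beliefs for slots $m,\ldots,k$, and past decisions) to a decision $a_k$. The reward in slot $t$ is $\pi_t(a_t)$ and $V_m(\pi_m,\{\mathfrak{A}_k\})=E\big[\sum_{t=1}^m\pi_t(a_t)\big]$ is the expected total reward with initial belief $\pi_m$. Sum capacity. $C_{\mathrm{sum}}(N)=\max_{\{\mathfrak{A}_k\}_{k\ge1}}\lim_{m\to\infty}\frac{V_m(\pi_{ss},\{\mathfrak{A}_k\}_{k\ge1})}{m}$, where $\pi_{ss}(i)=p_s$ for all $i$. Genie-aided system. The same system, except that the feedback $f_k$ originating in slot $k$ consists of the channel states in slot $k$ of all $N$ users, $(S_k(1),\ldots,S_k(N))$; this cumulative feedback arrives together with delay $D(a_k,k)$. $C_{\mathrm{sum}}^{\mathrm{genie}}(N)$ is its sum capacity, defined in the same way. Explicit values of the two bounds (empty products equal $1$): $C_{\mathrm{sum}}(2)=\sum_{l=0}^{\infty}[p_sT^l(p)+(1-p_s)p_s]P(D\le l)\prod_{d=0}^{l-1}P(D>d)$ and $C_{\mathrm{sum}}^{\mathrm{genie}}(N)=\sum_{l=0}^{\infty}[(1-(1-p_s)^N)T^l(p)+(1-p_s)^NT^l(r)]P(D\le l)\prod_{d=0}^{l-1}P(D>d)$.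 *)

(* Defs.v *)
From HB Require Import structures.
From mathcomp Require Export all_boot all_order all_algebra.
From mathcomp Require Export all_classical all_reals all_analysis.
Export Order.TTheory GRing.Theory Num.Theory.
Export numFieldNormedType.Exports.

#[export] Set Implicit Arguments.
#[export] Unset Strict Implicit.
#[export] Unset Printing Implicit Defensive.

Local Open Scope classical_set_scope.
Local Open Scope ring_scope.

Definition pr d (T : measurableType d) (R : realType) (P : probability T R)
  (A : set T) : R := fine (P A).

(* By the convention x / 0 = 0, this is 0 when B is a null event. *)
Definition cond_pr d (T : measurableType d) (R : realType)
  (P : probability T R) (A B : set T) : R := pr P (A `&` B) / pr P B.

(* Mutual independence of finitely many discrete random elements: every
   preimage is an event. Taking some A i to be setT gives the product rule for
   subfamilies. *)
Definition indep_family d (T : measurableType d) (R : realType)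
    (P : probability T R) (I : finType) (U : Type) (X : I -> T -> U) : Prop :=
  forall A : I -> set U,
    pr P [set w | forall i, A i (X i w)] =
    \prod_(i : I) pr P [set w | A i (X i w)].

Definition indep_pair d (T : measurableType d) (R : realType)
    (P : probability T R) (U V : Type) (X : T -> U) (Y : T -> V) : Prop :=
  forall (A : set U) (B : set V),
    pr P [set w | A (X w) /\ B (Y w)] =
    pr P [set w | A (X w)] * pr P [set w | B (Y w)].

Definition is_pmf (R : realType) (PD : nat -> R) : Prop :=
  (forall d, 0 <= PD d) /\ series PD @ \oo --> (1 : R).

(* Channels and delays over the slots m, m-1, ..., 1, slot m coming first;
   state t i and delay i t are constrained, and used, only for 1 <= t <= m.
   The index k : 'I_m stands for slot k.+1. *)
Record downlink (R : realType) (N : nat) (p r : R) (PD : nat -> R)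
    (pi_init : 'I_N -> R) (m : nat) := Downlink {
  dl_display : measure_display;
  dl_space : measurableType dl_display;
  dl_prob : probability dl_space R;
  state : nat -> 'I_N -> {RV dl_prob >-> bool};
  delay : 'I_N -> nat -> {RV dl_prob >-> nat};
  state_init : forall i, pr dl_prob [set w | state m i w] = pi_init i;
  state_markov : forall i t (h : nat -> bool), (1 <= t < m)%N ->
    let past := [set w | forall u, (t < u <= m)%N -> state u i w = h u] in
    0 < pr dl_prob past ->
    cond_pr dl_prob [set w | state t i w] past = if h t.+1 then p else r;
  state_indep :
    indep_family dl_prob (fun (i : 'I_N) w (k : 'I_m) => state k.+1 i w);
  delay_law : forall i t d, (1 <= t <= m)%N ->
    pr dl_prob [set w | delay i t w = d] = PD d;
  delay_indep :
    indep_family dl_prob (fun (x : 'I_N * 'I_m) w => delay x.1 x.2.+1 w);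
  state_delay_indep :
    indep_pair dl_prob (fun w (i : 'I_N) (k : 'I_m) => state k.+1 i w)
                       (fun w (i : 'I_N) (k : 'I_m) => delay i k.+1 w)
}.

(* Information available in slot k: one entry ((t, a_t), o) for each past slot
   t = m, ..., k+1 in this order, where o = Some (u, f_t) if the feedback f_t
   has arrived, u being the slot at the end of which it did, and o = None
   otherwise. *)
Definition information (N : nat) (F : Type) : Type :=
  seq ((nat * 'I_N) * option (nat * F)).

Definition policy (N : nat) (F : Type) : Type :=
  nat -> information N F -> 'I_N.

(* The feedback generated when user a is scheduled and the channels are in
   the joint state s. *)
Definition arq_feedback (N : nat) (a : 'I_N) (s : 'I_N -> bool) : bool := s a.

Definition genie_feedback (N : nat) (a : 'I_N) (s : 'I_N -> bool) :
  {ffun 'I_N -> bool} := finfun s.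

Section Run.
Variables (R : realType) (N : nat) (p r : R) (PD : nat -> R).
Variables (pi_init : 'I_N -> R) (m : nat).
Variable sys : downlink p r PD pi_init m.
Variables (F : Type) (feedback : 'I_N -> ('I_N -> bool) -> F).
Variable A : policy N F.

Definition observe (k : nat) (w : dl_space sys) (x : nat * 'I_N) :
    (nat * 'I_N) * option (nat * F) :=
  let: (t, a) := x in
  let u := (t - delay sys a t w)%N in
  (x, if (k < u)%N then Some (u, feedback a (fun i => state sys t i w))
      else None).

(* The pairs (t, a_t) for the first n slots t = m, ..., m-n+1. *)
Fixpoint decisions (w : dl_space sys) (n : nat) : seq (nat * 'I_N) :=
  if n is n'.+1 then
    let k := (m - n')%N in
    rcons (decisions w n') (k, A k (map (observe k w) (decisions w n')))
  else [::].

Definition info (k : nat) (w : dl_space sys) : information N F :=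
  map (observe k w) (decisions w (m - k)).

Definition action (k : nat) (w : dl_space sys) : 'I_N := A k (info k w).

Definition belief (k : nat) (i : 'I_N) (w : dl_space sys) : R :=
  cond_pr (dl_prob sys) [set w' | state sys k i w']
                        [set w' | info k w' = info k w].

Definition total_reward : R :=
  fine ('E_(dl_prob sys)[fun w =>
    \sum_(1 <= t < m.+1) belief t (action t w) w]).

End Run.

Definition stationary_on (R : realType) (p r : R) : R := r / (1 - (p - r)).

(* One realization for each horizon m, started at the stationary belief. *)
Definition stationary_downlinks (R : realType) (N : nat) (p r : R)
    (PD : nat -> R) : Type :=
  forall m : nat, downlink p r PD (fun _ : 'I_N => stationary_on p r) m.

Definition achievable_rate (R : realType) (N : nat) (p r : R) (PD : nat -> R)
    (sys : stationary_downlinks N p r PD)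
    (F : Type) (feedback : 'I_N -> ('I_N -> bool) -> F) (c : R) : Prop :=
  exists A : policy N F,
    (total_reward (sys m) feedback A / m%:R) @[m --> \oo] --> c.

(* c is the maximum, over the policies for which it exists, of the limiting
   expected reward per slot. *)
Definition is_max_rate (R : realType) (N : nat) (p r : R) (PD : nat -> R)
    (sys : stationary_downlinks N p r PD)
    (F : Type) (feedback : 'I_N -> ('I_N -> bool) -> F) (c : R) : Prop :=
  achievable_rate sys feedback c /\
  forall c', achievable_rate sys feedback c' -> c' <= c.

Definition is_sum_capacity (R : realType) (N : nat) (p r : R) (PD : nat -> R)
    (sys : stationary_downlinks N p r PD) (c : R) : Prop :=
  is_max_rate sys (@arq_feedback N) c.

Definition is_genie_sum_capacity (R : realType) (N : nat) (p r : R)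
    (PD : nat -> R) (sys : stationary_downlinks N p r PD) (c : R) : Prop :=
  is_max_rate sys (@genie_feedback N) c.

(* Main.v *)
Require Import Defs.
From mathcomp Require Import zify lra ring.
Local Open Scope classical_set_scope.
Local Open Scope ring_scope.

(** By the tower property, the total reward of a policy is the sum over the slots of
    the probability that the scheduled channel is ON, so it depends only on the joint
    law of the channel states and arrival slots. In a stationary system, the law on
    any window of slots and any set of users is that of a smaller stationary system.
    Playing two policies one after the other, the second one forgetting what happened
    before, thus makes the optimal finite-horizon value superadditive in the horizon,
    and its average per slot converges by Fekete's lemma. The limit is achieved by a
    single policy, because the scheduler can read the horizon off its information and
    play a nearly optimal policy for that horizon. The bounds already hold for the
    finite-horizon values: [N] users can be scheduled as if only two were present, and
    the genie-aided scheduler can ignore the states of the users it did not schedule. *)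

(** * Real-valued probabilities and finite-valued random elements *)

Section Pr.
Context d (T : measurableType d) (R : realType) (P : probability T R).

Lemma fineK_prob (A : set T) : measurable A -> (pr P A)%:E = P A.
Proof. by move=> mA; rewrite /pr fineK// fin_num_measure. Qed.

Lemma pr_ge0 (A : set T) : 0 <= pr P A.
Proof. exact: fine_ge0. Qed.

Lemma pr_le1 (A : set T) : measurable A -> pr P A <= 1.
Proof. by move=> mA; rewrite -lee_fin fineK_prob// probability_le1. Qed.

Lemma pr_setT : pr P setT = 1.
Proof. by rewrite /pr probability_setT. Qed.

Lemma pr_le (A B : set T) : measurable A -> measurable B -> A `<=` B ->
  pr P A <= pr P B.
Proof.
by move=> mA mB AB; rewrite -lee_fin !fineK_prob//; apply: le_measure; rewrite ?inE.
Qed.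

Lemma pr_split (A B : set T) : measurable A -> measurable B ->
  pr P A = pr P (A `&` B) + pr P (A `&` ~` B).
Proof.
move=> mA mB; have mAB := measurableI _ _ mA mB.
have mABC := measurableI _ _ mA (measurableC mB).
apply: EFin_inj; rewrite EFinD !fineK_prob//.
rewrite -measureU//; first by rewrite -setIUr setUv setIT.
by rewrite setIACA setICr setI0.
Qed.

End Pr.

Section FiniteValued.
Context d (T : measurableType d) (R : realType) (P : probability T R).
Variables (U : finType) (X : T -> U).
Hypothesis mX : forall x, measurable [set w | X w = x].

Lemma measurable_fin_valued (Q : set U) : measurable [set w | Q (X w)].
Proof.
rewrite (_ : [set w | Q (X w)] = \bigcup_(x in Q) [set w | X w = x]).
  by apply: fin_bigcup_measurable => // x _; exact: mX.
by apply/seteqP; split=> [w Qw|w [x Qx /= ->//]]; exists (X w).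
Qed.

Lemma expectation_fin_valued (h : U -> R) :
  fine 'E_P[fun w => h (X w)] = \sum_x h x * pr P [set w | X w = x].
Proof.
rewrite unlock.
under eq_integral => w _.
  rewrite (_ : (h (X w))%:E =
    \sum_(x : U) (h x)%:E * (\1_[set w | X w = x] w)%:E)%E; last first.
    rewrite (bigD1 (X w))//= indicE mem_set// mule1 big1 ?adde0// => x xX.
    by rewrite indicE memNset ?mule0//= => /esym/eqP; rewrite (negbTE xX).
  over.
have iX x : P.-integrable setT (fun w => (\1_[set w | X w = x] w)%:E).
  exact: integrable_indic.
rewrite integral_sum//=; last by move=> x; apply: integrableZl.
under eq_bigr => x _.
  rewrite integralZl//.
  rewrite integral_indic// setIT -[X in (_ * X)%E]fineK_prob// -EFinM; over.
by rewrite sumEFin.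
Qed.

Lemma pr_fin_valued (Q : pred U) :
  pr P [set w | Q (X w)] = \sum_(x | Q x) pr P [set w | X w = x].
Proof.
transitivity (fine 'E_P[fun w => (Q (X w))%:R : R]).
  rewrite (_ : (fun w => _) = \1_[set w | Q (X w)]).
    by rewrite expectation_indic//; exact: (measurable_fin_valued (fun x => Q x)).
  by apply/funext => w; rewrite indicE mem_setE.
rewrite (expectation_fin_valued (fun x => (Q x)%:R)) [RHS]big_mkcond.
by apply: eq_bigr => x _; case: (Q x); rewrite ?mul1r ?mul0r.
Qed.

(* Tower property: averaging the conditional probability of the event [s _ (a _)]
   given [Y], where the choice [a] is made from [Y]. *)
Lemma expectation_cond_pr (I V : Type) (Y : U -> V) (a : V -> I)
    (s : U -> I -> bool) :
  fine 'E_P[fun w => cond_pr P [set w' | s (X w') (a (Y (X w)))]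
                               [set w' | Y (X w') = Y (X w)]] =
  pr P [set w | s (X w) (a (Y (X w)))].
Proof.
pose q x := pr P [set w | X w = x].
pose W v := \sum_(x | `[< Y x = v >]) q x.
pose C i v := \sum_(x | `[< Y x = v >] && s x i) q x.
have CE i v : pr P ([set w | s (X w) i] `&` [set w | Y (X w) = v]) = C i v.
  rewrite /C -(pr_fin_valued (fun x => `[< Y x = v >] && s x i)).
  congr pr; apply/seteqP; split=> w /=; last by move=> /andP[/asboolP].
  by move=> [? ?]; apply/andP; split=> //; exact/asboolP.
have WE v : pr P [set w | Y (X w) = v] = W v.
  rewrite /W -(pr_fin_valued (fun x => `[< Y x = v >])).
  by congr pr; apply/seteqP; split=> w /= /asboolP.
rewrite (expectation_fin_valued (fun x => cond_pr P [set w' | s (X w') (a (Y x))]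
                               [set w' | Y (X w') = Y x])).
rewrite /cond_pr (pr_fin_valued (fun x => s x (a (Y x)))).
(* Exchanging the two sums leaves, for each [y], the weight of the fibre of [Y] through [y] divided
   by itself. *)
transitivity (\sum_x \sum_y
    if `[< Y y = Y x >] && s y (a (Y y)) then q y * (q x / W (Y y)) else 0).
  apply: eq_bigr => x _; rewrite CE WE -/(q x) -mulrA mulr_suml big_mkcond.
  apply: eq_bigr => y _; case: asboolP => //= ->.
  by case: ifP => // _; rewrite [_^-1 * _]mulrC.
rewrite exchange_big [RHS]big_mkcond; apply: eq_bigr => y _.
case: ifP => sy; last by apply: big1 => x _; rewrite andbF.
transitivity (q y * (W (Y y) / W (Y y))).
  rewrite [X in _ * (X / _)]/W mulr_suml mulr_sumr [RHS]big_mkcond.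
  apply: eq_bigr => x _; rewrite andbT.
  by rewrite (_ : `[< Y y = Y x >] = `[< Y x = Y y >])//; apply/asboolP/asboolP.
(* On a null fibre the quotient is 0 by convention instead of 1, but then [y] itself has weight
   0. *)
have [W0|W0] := eqVneq (W (Y y)) 0; last by rewrite mulfV// mulr1.
have q0 : q y = 0; last by rewrite q0 mul0r; exact: esym q0.
apply/eqP; rewrite eq_le pr_ge0 andbT -[leRHS]W0 /W (bigD1 y)/=; last exact/asboolP.
rewrite lerDl; apply: sumr_ge0 => x _; exact: pr_ge0.
Qed.
End FiniteValued.

Lemma measurable_eq_RV d (T : measurableType d) d' (U : measurableType d')
    (R : realType) (P : probability T R) (X : {RV P >-> U}) (x : U) :
  measurable [set x] -> measurable [set w | X w = x].
Proof.
by move=> mx; exact: (measurable_funPTI X mx).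
Qed.

(** * Law of a stationary channel on a window of slots *)

Definition init_law (R : realType) (p r : R) (b : bool) : R :=
  if b then stationary_on p r else 1 - stationary_on p r.

Definition transition (R : realType) (p r : R) (b c : bool) : R :=
  let q := if b then p else r in if c then q else 1 - q.

(** Time runs downwards: the path over the slots [a < t <= b] starts in slot [b], and each factor
    leads from slot [t.+1] to slot [t]. *)
Definition path_law (R : realType) (p r : R) (a b : nat) (h : nat -> bool) : R :=
  init_law p r (h b) * \prod_(a.+1 <= t < b) transition p r (h t.+1) (h t).

(** Balance equation of the two-state chain; [p + (1 - r) < 2] keeps the denominator [1 - (p - r)]
    positive. *)
Lemma transition_stationary (R : realType) (p r : R) (c : bool) : r < p ->
  p + (1 - r) < 2 ->
  init_law p r true * transition p r true c +
  init_law p r false * transition p r false c = init_law p r c.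
Proof.
move=> rp pr2; have nz : 1 - (p - r) != 0 by rewrite subr_eq0; apply/eqP; lra.
by case: c; rewrite /init_law /transition /stationary_on /=; field.
Qed.

Section ChannelLaw.
Variables (R : realType) (N : nat) (p r : R) (PD : nat -> R) (m : nat).
Variable sys : downlink p r PD (fun _ : 'I_N => stationary_on p r) m.
Variable i : 'I_N.
Implicit Types (a b n t : nat) (h : nat -> bool).
Local Notation P := (dl_prob sys).

Lemma measurable_state t c : measurable [set w | state sys t i w = c].
Proof. exact: measurable_eq_RV. Qed.

Lemma measurable_path a b h :
  measurable [set w | forall u, (a < u <= b)%N -> state sys u i w = h u].
Proof.
rewrite (_ : [set w | _] =
  \bigcap_(u in [set u | (a < u <= b)%N]) [set w | state sys u i w = h u]).
  by apply: bigcap_measurableType => u _; exact: measurable_state.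
by apply/seteqP; split.
Qed.

Lemma pr_split_state (A : set (dl_space sys)) t : measurable A ->
  pr P A = pr P (A `&` [set w | state sys t i w = true]) +
           pr P (A `&` [set w | state sys t i w = false]).
Proof.
move=> mA; rewrite (pr_split P mA (measurable_state t true)); congr (_ + pr P (_ `&` _)).
by apply/seteqP; split=> w /=; case: (state sys t i w).
Qed.

(** Chain rule: descending from slot [m], each new slot contributes one transition factor by the
    Markov property. *)
Lemma pr_path_top a h : (a < m)%N ->
  pr P [set w | forall u, (a < u <= m)%N -> state sys u i w = h u] =
  path_law p r a m h.
Proof.
move=> am; rewrite -(subKn (ltnW am)).
have : (0 < m - a <= m)%N by rewrite subn_gt0 am leq_subr.
elim: (m - a)%N => [//|j IH] /andP[_ jm].
set t := (m - j)%N.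
have [j0|j0] := posnP j.
  rewrite j0 /path_law big_geq ?mulr1; last by lia.
  rewrite (_ : [set w | _] = [set w | state sys m i w = h m]); last first.
    apply/seteqP; split=> w /= H; first by apply: H; lia.
    by move=> u um; rewrite (_ : u = m)//; lia.
  rewrite /init_law; have s1 := state_init sys i; case: (h m) => //.
  have := pr_split_state m measurableT; rewrite !setTI pr_setT s1 => ->.
  by rewrite addrC addKr.
have tm : (1 <= t < m)%N by rewrite /t; lia.
have -> : (m - j.+1)%N = t.-1 by rewrite /t; lia.
have := IH; rewrite -/t => {}IH.
have {}IH := IH ltac:(lia).
set A := [set w | _] in IH.
have mA : measurable A by exact: measurable_path.
have AE c : pr P (A `&` [set w | state sys t i w = c]) =
            pr P A * transition p r (h t.+1) c.
  (* The Markov property is assumed for pasts of positive probability; after a null past both sides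
     vanish. *)
  have [A0|A0] := eqVneq (pr P A) 0.
    rewrite A0 mul0r; apply/eqP; rewrite eq_le pr_ge0 -A0 andbT.
    have mAc := measurableI _ _ mA (measurable_state t c).
    exact: pr_le.
  have /(@state_markov _ _ _ _ _ _ _ sys i t h tm) : 0 < pr P A by rewrite lt_def A0 pr_ge0.
  rewrite /cond_pr setIC -/A => /(canRL (divfK A0)) E.
  rewrite /transition; case: c; first by rewrite E mulrC.
  have := pr_split_state t mA; rewrite E mulrBr mulr1 [_ * pr P A]mulrC => /eqP.
  by rewrite addrC -subr_eq => /eqP.
rewrite (_ : [set w | _] = A `&` [set w | state sys t i w = h t]); last first.
  apply/seteqP; split=> w /=.
    by move=> H; split=> [u ut|]; apply: H; lia.
  move=> [H Ht] u ut; have [->//|nt] := eqVneq u t.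
  by apply: H; move/eqP: nt; lia.
rewrite AE IH /path_law -mulrA; congr (_ * _).
have /andP[t0 tltm] := tm.
by rewrite (prednK t0) [RHS](big_ltn tltm) mulrC.
Qed.

Hypotheses (rp : r < p) (pr2 : p + (1 - r) < 2).

(** Induction on [m - b]: the path is extended by the slot just before it in time, and summing over
    the state there, the stationary law absorbs the extra slot. *)
Lemma pr_path a b h : (a < b <= m)%N ->
  pr P [set w | forall u, (a < u <= b)%N -> state sys u i w = h u] =
  path_law p r a b h.
Proof.
move=> /andP[ab bm]; rewrite -(subKn bm).
have : (a < m - (m - b))%N by rewrite subKn.
elim: (m - b)%N h => [|j IH] h aj; first by rewrite subn0 in aj *; exact: pr_path_top.
have {}IH := IH ^~ ltac:(lia).
set c := (m - j.+1)%N in aj *; have cE : (m - j)%N = c.+1 by rewrite /c; lia.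
rewrite cE in IH; pose h' x := fun u => if u == c.+1 then x else h u.
rewrite (@pr_split_state _ c.+1); last exact: measurable_path.
have E x : pr P ([set w | forall u, (a < u <= c)%N -> state sys u i w = h u]
   `&` [set w | state sys c.+1 i w = x]) =
   init_law p r x * transition p r x (h c) *
   \prod_(a.+1 <= t < c) transition p r (h t.+1) (h t).
  transitivity (path_law p r a c.+1 (h' x)).
    rewrite -IH; congr pr; apply/seteqP; split=> w /=.
      move=> [H Hc] u uc; rewrite /h'; case: eqP => [->//|/eqP nu].
      by apply: H; move/eqP: nu; lia.
    move=> H; split=> [u uc|]; last by rewrite H /h' ?eqxx//; lia.
    by rewrite H /h'; [case: eqP => //; lia|lia].
  rewrite /path_law {1}/h' eqxx big_nat_recr/=; last by lia.
  rewrite mulrA mulrAC /h' eqxx; case: eqP => [|_]; first lia.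
  congr (_ * _); apply: eq_big_nat => t tc.
  by rewrite !ifF//; apply/negbTE/eqP; lia.
by rewrite !E -mulrDl transition_stationary.
Qed.

(** An empty window is treated apart because [path_law] always includes the factor of an initial
    slot. *)
Definition window_law n h : R := if n is n'.+1 then path_law p r 0 n h else 1.

(** Independence of the shift [n] is what lets a run start afresh in the middle of a longer one. *)
Lemma pr_window n k h : (n + k <= m)%N ->
  pr P [set w | forall t, (0 < t <= k)%N -> state sys (t + n) i w = h t] =
  window_law k h.
Proof.
move=> nk; case: k nk => [|k] nk /=.
  rewrite (_ : [set w | _] = setT) ?pr_setT//.
  by apply/seteqP; split=> // w _ t; lia.
rewrite (_ : [set w | _] = [set w | forall u, (n < u <= n + k.+1)%N ->
    state sys u i w = h (u - n)%N]); last first.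
  apply/seteqP; split=> w /= H u un; last by rewrite H ?addnK//; lia.
  by rewrite -H ?subnK//; lia.
rewrite (@pr_path n (n + k.+1)%N (fun u => h (u - n)%N)); last by lia.
rewrite /path_law (addnC n) addnK; congr (_ * _).
rewrite -{1}[n.+1]add1n big_addn addnK; apply: eq_big_nat => t t0.
by rewrite -addSn !addnK.
Qed.
End ChannelLaw.

(** * Joint law of channel states and arrival slots *)

Lemma prod_injective (R : comPzSemiRingType) (I J : finType) (f : I -> J)
    (F : J -> R) : injective f -> (forall j, j \notin codom f -> F j = 1) ->
  \prod_j F j = \prod_i F (f i).
Proof.
move=> fI F1; rewrite (bigID (fun j => j \in f @: [set: I]%SET))/= [X in _ * X]big1.
  by rewrite mulr1 big_imset/=; [apply: eq_bigl => i; rewrite inE|move=> ? ? _ _ /fI].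
move=> j jf; apply: F1; apply: contra jf => /codomP[i ->].
by rewrite imset_f// inE.
Qed.

(** Defined from [PD] alone, so that laws on different probability spaces can be compared. *)
Definition delay_prob (R : realType) (PD : nat -> R) (B : set nat) : R :=
  fine (\sum_(d <oo | d \in B) (PD d)%:E)%E.

(* A configuration records, for every user and slot of a window of [m] slots, the
   channel state and the slot at the end of which feedback generated there would
   arrive, 0 standing for arrivals after the window. The coordinate [(a, k)]
   describes slot [k.+1]. *)
Definition config (N m : nat) := {ffun 'I_N * 'I_m -> bool * 'I_m.+1}.

Section Config.
Variables (N m : nat).
Implicit Type x : config N m.

(** Slot [t] is stored at index [t.-1]; the value is meaningful for [1 <= t <= m], and [false] is a
    filler above the window. *)
Definition config_state x (t : nat) (a : 'I_N) : bool :=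
  if insub t.-1 is Some k then (x (a, k)).1 else false.

Definition config_arrival x (a : 'I_N) (t : nat) : nat :=
  if insub t.-1 is Some k then (x (a, k)).2 else 0%N.

Definition config_law (R : realType) (p r : R) (PD : nat -> R) x : R :=
  (\prod_(a < N) window_law p r m (config_state x ^~ a)) *
  \prod_(y : 'I_N * 'I_m)
    delay_prob PD [set d | (y.2.+1 - d)%N = (x y).2].

End Config.

Lemma pr_delay (R : realType) (N : nat) (p r : R) (PD : nat -> R)
    (pi_init : 'I_N -> R) (m : nat) (sys : downlink p r PD pi_init m)
    (i : 'I_N) (t : nat) (B : set nat) : (1 <= t <= m)%N ->
  pr (dl_prob sys) [set w | B (delay sys i t w)] = delay_prob PD B.
Proof.
move=> tm; rewrite /pr /delay_prob; congr fine.
have mD x : measurable [set w | delay sys i t w = x] by exact: measurable_eq_RV.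
rewrite (_ : [set w | _] = \bigcup_(x in B) [set w | delay sys i t w = x]); last first.
  by apply/seteqP; split=> [w Bw|w [x Bx /= ->//]]; exists (delay sys i t w).
rewrite measure_bigcup//; last by move=> x y _ _ [w [/= <- <-]].
by apply: eq_eseriesr => d _; rewrite -(delay_law sys i d tm) fineK_prob.
Qed.

Section Observed.
Variables (R : realType) (N N' : nat) (p r : R) (PD : nat -> R) (M : nat).
Variable sys : downlink p r PD (fun _ : 'I_N' => stationary_on p r) M.
Variables (iota : 'I_N -> 'I_N') (n m : nat).
Local Notation P := (dl_prob sys).

(** Slots are counted from the bottom of the window, so truncated subtraction sends every arrival
    after the window to 0. This leaves finitely many values although delays may be unbounded, and
    [inord] never overflows. *)
Definition observed (w : dl_space sys) : config N m :=
  [ffun y : 'I_N * 'I_m =>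
    (state sys (y.2.+1 + n) (iota y.1) w,
      inord (y.2.+1 - delay sys (iota y.1) (y.2.+1 + n) w))].

Lemma observed_arrival (w : dl_space sys) (a : 'I_N) (k : 'I_m) :
  (observed w (a, k)).2 = (k.+1 - delay sys (iota a) (k.+1 + n) w)%N :> nat.
Proof. by rewrite ffunE inordK//=; have := ltn_ord k; lia. Qed.

Lemma observed_eq (x : config N m) : [set w | observed w = x] =
  [set w | (forall a (k : 'I_m), state sys (k.+1 + n) (iota a) w = (x (a, k)).1) /\
    (forall a (k : 'I_m),
       (k.+1 - delay sys (iota a) (k.+1 + n) w)%N = (x (a, k)).2)].
Proof.
apply/seteqP; split=> w /=.
  by move=> <-; split=> a k; rewrite ?observed_arrival// ffunE.
move=> [H1 H2]; apply/ffunP => -[a k].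
rewrite [LHS]surjective_pairing [RHS]surjective_pairing; congr pair.
  by rewrite ffunE H1.
by apply/val_inj; rewrite /= observed_arrival H2.
Qed.

Lemma measurable_observed (x : config N m) : measurable [set w | observed w = x].
Proof.
rewrite observed_eq (_ : [set w | _] = \bigcap_(y : 'I_N * 'I_m)
  ([set w | state sys (y.2.+1 + n) (iota y.1) w = (x y).1] `&`
   (delay sys (iota y.1) (y.2.+1 + n) @^-1` [set d | (y.2.+1 - d)%N = (x y).2]))).
  apply: fin_bigcap_measurable => // y _; apply: measurableI.
    exact: measurable_eq_RV.
  by apply: measurable_funPTI.
apply/seteqP; split=> w /=; first by move=> [H1 H2] [a k] _; split; [exact: H1|exact: H2].
by move=> H; split=> a k; have [] := H (a, k) I.
Qed.

Hypotheses (iotaI : injective iota) (nm : (n + m <= M)%N).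
Hypotheses (rp : r < p) (pr2 : p + (1 - r) < 2).

(** The independence assumptions factor the event over users and slots; by stationarity neither [n]
    nor [iota] is left in the result. *)
Lemma pr_observed (x : config N m) :
  pr P [set w | observed w = x] = config_law p r PD x.
Proof.
have shP (k : 'I_m) : (k + n < M)%N by have := ltn_ord k; lia.
pose sh k := Ordinal (shP k).
have shI : injective sh.
  by move=> k l [] /addIn /val_inj.
rewrite observed_eq.
have -> := state_delay_indep sys
  [set S | forall a k, S (iota a) (sh k) = (x (a, k)).1]
  [set D | forall a (k : 'I_m), (k.+1 - D (iota a) (sh k))%N = (x (a, k)).2].
congr (_ * _).
  pose A (b : 'I_N') := [set f : 'I_M -> bool |
    forall a, iota a = b -> forall k, f (sh k) = (x (a, k)).1].
  transitivity (\prod_b pr P [set w | A b (fun k : 'I_M => state sys k.+1 b w)]).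
    rewrite -(state_indep sys); congr pr; apply/seteqP; split=> w /= H.
      by move=> b a <- k; exact: H.
    by move=> a k; exact: (H (iota a) a).
  (* Users outside the image of [iota] are unconstrained and contribute a factor 1. *)
  rewrite (prod_injective iotaI); last first.
    move=> b bN; rewrite (_ : [set w | _] = setT) ?pr_setT//.
    by apply/seteqP; split=> // w _ a ab; rewrite -ab codom_f in bN.
  apply: eq_bigr => a _.
  rewrite -(@pr_window _ _ _ _ _ _ sys (iota a) rp pr2 n m)//.
  congr pr; apply/seteqP; split=> w /= H.
    move=> t tm; have tm' : (t.-1 < m)%N by lia.
    rewrite /config_state (insubT (fun k => (k < m)%N) tm') -(H a erefl).
    by rewrite /= -addSn prednK//; lia.
  move=> b /iotaI -> k; have /= := H k.+1 (ltn_ord k).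
  by rewrite /config_state/= valK.
pose J (y : 'I_N * 'I_m) := (iota y.1, sh y.2).
have JI : injective J by move=> [a k] [b l] [/iotaI -> /addIn /val_inj ->].
pose B (z : 'I_N' * 'I_M) := [set d : nat | forall y, J y = z -> (y.2.+1 - d)%N = (x y).2].
transitivity (\prod_z pr P [set w | B z (delay sys z.1 z.2.+1 w)]).
  rewrite -(delay_indep sys); congr pr; apply/seteqP; split=> w /= H.
    by move=> z [a k] <-; exact: H.
  by move=> a k; exact: (H (J (a, k)) (a, k)).
rewrite (prod_injective JI); last first.
  move=> z zN; rewrite (_ : [set w | _] = setT) ?pr_setT//.
  by apply/seteqP; split=> // w _ y yz; rewrite -yz codom_f in zN.
apply: eq_bigr => y _; rewrite pr_delay; last exact: (shP y.2).
congr delay_prob; apply/seteqP; split=> d /= H; first exact: H.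
by move=> y' /JI ->.
Qed.

End Observed.

(** * Deterministic runs and simulation of one run inside another *)

Section DeterministicRun.
Variables (N : nat) (F : Type) (feedback : 'I_N -> ('I_N -> bool) -> F).
Variables (A : policy N F) (m : nat).
Variables (st : nat -> 'I_N -> bool) (arrival : 'I_N -> nat -> nat).

(** The run is replayed from prescribed states and arrival slots, so that it can be evaluated both
    at a sample point and on a configuration. *)
Definition run_observe (k : nat) (x : nat * 'I_N) :
    (nat * 'I_N) * option (nat * F) :=
  let: (t, a) := x in
  (x, if (k < arrival a t)%N then Some (arrival a t, feedback a (st t)) else None).

Fixpoint run_decisions (j : nat) : seq (nat * 'I_N) :=
  if j is j'.+1 then
    let k := (m - j')%N in
    rcons (run_decisions j') (k, A k (map (run_observe k) (run_decisions j')))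
  else [::].

Definition run_info (k : nat) : information N F :=
  map (run_observe k) (run_decisions (m - k)).

Definition run_action (k : nat) : 'I_N := A k (run_info k).

Lemma size_run_decisions j : size (run_decisions j) = j.
Proof. by elim: j => //= j IH; rewrite size_rcons IH. Qed.

Lemma run_decisions_slots j : (j <= m)%N ->
  {in run_decisions j, forall x, (0 < x.1 <= m)%N}.
Proof.
elim: j => //= j IH jm x; rewrite mem_rcons inE => /orP[/eqP ->/=|]; first lia.
by apply: IH; exact: ltnW.
Qed.

End DeterministicRun.

(* How a scheduler sees a run of a smaller system inside a larger one: slots are
   shifted by [n], users are renamed and feedback is reduced. *)
Definition translate (N N' : nat) (F F' : Type) (n : nat) (inv : 'I_N' -> 'I_N)
    (red : 'I_N' -> F' -> F) (x : (nat * 'I_N') * option (nat * F')) :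
    (nat * 'I_N) * option (nat * F) :=
  ((x.1.1 - n, inv x.1.2)%N,
   omap (fun uf => ((uf.1 - n)%N, red x.1.2 uf.2)) x.2).

Section Simulation.
Variables (N N' : nat) (F F' : Type).
Variables (feedback : 'I_N -> ('I_N -> bool) -> F).
Variables (feedback' : 'I_N' -> ('I_N' -> bool) -> F').
Variables (iota : 'I_N -> 'I_N') (inv : 'I_N' -> 'I_N) (red : 'I_N' -> F' -> F).
Variables (n m e M : nat) (A : policy N F) (A' : policy N' F').
Hypothesis ME : M = (n + m + e)%N.
Hypothesis iotaK : cancel iota inv.
Hypothesis red_feedback : forall a s,
  red (iota a) (feedback' (iota a) s) = feedback a (s \o iota).
Hypothesis simA : forall k l, (0 < k <= m)%N ->
  A' (k + n)%N l = iota (A k (map (translate n inv red) (drop e l))).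

Section Run.
Variables (st : nat -> 'I_N -> bool) (arrival : 'I_N -> nat -> nat).
Variables (st' : nat -> 'I_N' -> bool) (arrival' : 'I_N' -> nat -> nat).
Hypothesis st_eq : forall t a, (0 < t <= m)%N -> st t a = st' (t + n)%N (iota a).
Hypothesis arrival_eq : forall t a, (0 < t <= m)%N ->
  arrival a t = (arrival' (iota a) (t + n) - n)%N.

Let dec := run_decisions feedback A m st arrival.
Let dec' := run_decisions feedback' A' M st' arrival'.

Lemma translate_observe k x : (0 < x.1 <= m)%N ->
  translate n inv red
    (run_observe feedback' st' arrival' (k + n) (x.1 + n, iota x.2)%N) =
  run_observe feedback st arrival k x.
Proof.
case: x => t a /= tm; rewrite /translate/= addnK iotaK (arrival_eq _ tm).
(* Visibility survives truncation: [k < u - n] iff [k + n < u], also when [u <= n]. *)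
rewrite [in RHS]ltn_subRL [(n + k)%N]addnC; case: ifP => //= _.
rewrite red_feedback; congr (_, Some (_, feedback _ _)).
by apply/funext => b /=; rewrite st_eq.
Qed.

(** [A'] disregards the first [e] entries and reads the others through [translate], so by induction
    it sees what [A] sees and decides accordingly. *)
Lemma drop_run_decisions j : (j <= m)%N ->
  drop e (dec' (e + j)) = [seq (x.1 + n, iota x.2)%N | x <- dec j].
Proof.
elim: j => [|j IH] jm.
  by rewrite addn0 drop_oversize// size_run_decisions.
have {}IH := IH (ltnW jm).
rewrite addnS /dec /dec' /= -/dec -/dec' drop_rcons; last first.
  by rewrite size_run_decisions leq_addr.
rewrite IH map_rcons; congr rcons => /=.
have -> : (M - (e + j))%N = (m - j + n)%N by lia.
rewrite simA; last by lia.
congr (_, iota (A _ _)); rewrite -map_drop IH -!map_comp.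
apply/eq_in_map => x /(run_decisions_slots (ltnW jm)) xm.
exact: translate_observe.
Qed.

Lemma translate_run_info k : (0 < k <= m)%N ->
  map (translate n inv red)
    (drop e (run_info feedback' A' M st' arrival' (k + n))) =
  run_info feedback A m st arrival k.
Proof.
move=> km; rewrite /run_info -map_drop.
have -> : (M - (k + n))%N = (e + (m - k))%N by lia.
rewrite drop_run_decisions; last by lia.
rewrite -!map_comp; apply/eq_in_map => x /run_decisions_slots xm.
by apply: translate_observe; apply: xm; lia.
Qed.

Lemma run_action_sim k : (0 < k <= m)%N ->
  run_action feedback' A' M st' arrival' (k + n) =
  iota (run_action feedback A m st arrival k).
Proof. by move=> km; rewrite /run_action simA// translate_run_info. Qed.

End Run.
End Simulation.

Lemma translate_id (N : nat) (F : Type) : translate 0 id (fun _ => id) =1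
  (id : (nat * 'I_N) * option (nat * F) -> _).
Proof. by case=> [[t a] [[u f]|]]; rewrite /translate/= !subn0. Qed.

(** Every policy simulates itself with shift 0 and no renaming, and the simulation only compares
    data of the slots 1 to [m]. *)
Lemma eq_run_info (N : nat) (F : Type) (feedback : 'I_N -> ('I_N -> bool) -> F)
    (m : nat) (A : policy N F) (st st' : nat -> 'I_N -> bool)
    (arrival arrival' : 'I_N -> nat -> nat) :
  (forall t a, (0 < t <= m)%N -> st t a = st' t a) ->
  (forall t a, (0 < t <= m)%N -> arrival a t = arrival' a t) ->
  forall k, (0 < k <= m)%N ->
  run_info feedback A m st arrival k = run_info feedback A m st' arrival' k.
Proof.
move=> stE arrE k km; have ME : m = (0 + m + 0)%N by rewrite addn0.
have simA l j : (0 < l <= m)%N ->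
    A (l + 0)%N j = A l (map (translate 0 id (fun _ => id)) (drop 0 j)).
  by rewrite drop0 (eq_map (@translate_id _ _)) map_id addn0.
have stE' t a : (0 < t <= m)%N -> st t a = st' (t + 0)%N a.
  by rewrite addn0; exact: stE.
have arrE' t a : (0 < t <= m)%N -> arrival a t = (arrival' a (t + 0) - 0)%N.
  by rewrite addn0 subn0; exact: arrE.
rewrite -(translate_run_info (feedback := feedback) (feedback' := feedback)
  (iota := id) (inv := id) (red := fun _ => id) ME (fun=> erefl)
  (fun _ _ => erefl) simA stE' arrE' km).
by rewrite drop0 (eq_map (@translate_id _ _)) map_id addn0.
Qed.

(** * Rewards as functions of the joint law *)

Definition slot_value (R : realType) (N : nat) (p r : R) (PD : nat -> R)
    (F : Type) (feedback : 'I_N -> ('I_N -> bool) -> F) (A : policy N F)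
    (m k : nat) : R :=
  \sum_(x : config N m | config_state x k
     (run_action feedback A m (config_state x) (config_arrival x) k))
    config_law p r PD x.

Section Reward.
Variables (R : realType) (p r : R) (PD : nat -> R).
Hypotheses (rp : r < p) (pr2 : p + (1 - r) < 2).

Section RunOfSystem.
Variables (N : nat) (M : nat).
Variable sys : downlink p r PD (fun _ : 'I_N => stationary_on p r) M.
Variables (F : Type) (feedback : 'I_N -> ('I_N -> bool) -> F) (A : policy N F).
Variable w : dl_space sys.
Let st t i := state sys t i w.
Let arr i t := (t - delay sys i t w)%N.

Lemma decisionsE j : decisions feedback A w j = run_decisions feedback A M st arr j.
Proof. by elim: j => //= j ->. Qed.

Lemma infoE k : info feedback A k w = run_info feedback A M st arr k.
Proof. by rewrite /info decisionsE. Qed.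

End RunOfSystem.

(** The state and, by the simulation, the decision in slot [k + n] are functions of the observed
    window, whose law is explicit. Since [slot_value] involves no probability space, systems with
    different horizons and numbers of users become comparable. *)
Lemma pr_slot_success (N N' : nat) (F F' : Type)
    (feedback : 'I_N -> ('I_N -> bool) -> F)
    (feedback' : 'I_N' -> ('I_N' -> bool) -> F')
    (iota : 'I_N -> 'I_N') (inv : 'I_N' -> 'I_N) (red : 'I_N' -> F' -> F)
    (n m e M : nat) (A : policy N F) (A' : policy N' F')
    (sys : downlink p r PD (fun _ : 'I_N' => stationary_on p r) M) :
  M = (n + m + e)%N -> cancel iota inv ->
  (forall a s, red (iota a) (feedback' (iota a) s) = feedback a (s \o iota)) ->
  (forall k l, (0 < k <= m)%N ->
    A' (k + n)%N l = iota (A k (map (translate n inv red) (drop e l)))) ->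
  forall k, (0 < k <= m)%N ->
  pr (dl_prob sys)
    [set w | state sys (k + n) (action feedback' A' (k + n) w) w] =
  slot_value p r PD feedback A m k.
Proof.
move=> ME iotaK redf simA k km.
have iotaI := can_inj iotaK.
have nmM : (n + m <= M)%N by rewrite ME leq_addr.
have mX := @measurable_observed _ _ _ _ _ _ _ sys iota n m.
pose X := @observed _ _ _ _ _ _ _ sys iota n m.
rewrite /slot_value; under eq_bigr do rewrite -(pr_observed sys iotaI nmM rp pr2).
rewrite -(@pr_fin_valued _ _ _ _ _ X mX (fun x => config_state x k
  (run_action feedback A m (config_state x) (config_arrival x) k))).
congr pr; apply/seteqP.
suff H w : state sys (k + n) (action feedback' A' (k + n) w) w =
  config_state (X w) k
   (run_action feedback A m (config_state (X w)) (config_arrival (X w)) k).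
  by split=> w /=; rewrite H.
have stE t a : (0 < t <= m)%N -> config_state (X w) t a = state sys (t + n) (iota a) w.
  move=> tm; have tm' : (t.-1 < m)%N by lia.
  by rewrite /config_state (insubT (fun k => (k < m)%N) tm') ffunE /= prednK//; lia.
have arrE t a : (0 < t <= m)%N -> config_arrival (X w) a t =
    (t + n - delay sys (iota a) (t + n) w - n)%N.
  move=> tm; have tm' : (t.-1 < m)%N by lia.
  rewrite /config_arrival (insubT (fun k => (k < m)%N) tm') observed_arrival /=.
  by rewrite prednK; lia.
rewrite stE// /action infoE.
congr (state sys _ _ w).
exact: (run_action_sim ME iotaK redf simA stE arrE km).
Qed.

Section TotalReward.
Variables (N : nat) (m : nat).
Variable sys : downlink p r PD (fun _ : 'I_N => stationary_on p r) m.
Variables (F : Type) (feedback : 'I_N -> ('I_N -> bool) -> F).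
Variable A : policy N F.
Local Notation P := (dl_prob sys).

(** Beliefs are functions of the finite-valued configuration, so the expectation is a finite sum to
    which the tower property applies slot by slot. *)
Lemma total_reward_success : total_reward sys feedback A =
  \sum_(1 <= t < m.+1) pr P [set w | state sys t (action feedback A t w) w].
Proof.
have mX := @measurable_observed _ _ _ _ _ _ _ sys id 0 m.
pose X := @observed _ _ _ _ _ _ _ sys id 0 m.
pose g t (x : config N m) := run_info feedback A m (config_state x) (config_arrival x) t.
have stE w t a : (0 < t <= m)%N -> config_state (X w) t a = state sys t a w.
  move=> tm; have tm' : (t.-1 < m)%N by lia.
  rewrite /config_state (insubT (fun k => (k < m)%N) tm') ffunE /= addn0.
  by rewrite prednK//; lia.
have arrE w t a : (0 < t <= m)%N ->
    config_arrival (X w) a t = (t - delay sys a t w)%N.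
  move=> tm; have tm' : (t.-1 < m)%N by lia.
  rewrite /config_arrival (insubT (fun k => (k < m)%N) tm') observed_arrival /=.
  by rewrite addn0 prednK; lia.
have gE w t : (0 < t <= m)%N -> info feedback A t w = g t (X w).
  move=> tm; rewrite infoE /g; symmetry.
  by apply: eq_run_info => // u a; [exact: stE|exact: arrE].
pose h t (x : config N m) := cond_pr P
  [set w' | config_state (X w') t (A t (g t x))] [set w' | g t (X w') = g t x].
rewrite /total_reward (_ : (fun w => _) = fun w => \sum_(1 <= t < m.+1) h t (X w)).
  rewrite (@expectation_fin_valued _ _ _ _ _ X mX (fun x => \sum_(1 <= t < m.+1) h t x)).
  under eq_bigr do rewrite mulr_suml.
  rewrite exchange_big/=; apply: eq_big_nat => t tm.
  rewrite -(@expectation_fin_valued _ _ _ _ _ X mX (h t)) /h.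
  rewrite (@expectation_cond_pr _ _ _ _ _ X mX _ _ (g t) (A t) (fun x => config_state x t)).
  congr pr; apply/seteqP.
  by split=> w /=; rewrite stE// -gE.
apply/funext => w; apply: eq_big_nat => t tm; rewrite /belief /h /action !gE//.
congr cond_pr; apply/seteqP; split=> w' /=; rewrite ?stE ?gE//.
Qed.

Lemma total_rewardE : total_reward sys feedback A =
  \sum_(1 <= t < m.+1) slot_value p r PD feedback A m t.
Proof.
rewrite total_reward_success; apply: eq_big_nat => t tm.
rewrite -(@pr_slot_success N N F F feedback feedback id id (fun _ => id)
  0 m 0 m A A sys)// ?addn0//.
by move=> k l _; rewrite drop0 (eq_map (@translate_id _ _)) map_id addn0.
Qed.

(** The weights in [slot_value] are formal products; [sys] realizes their sum as the probability of
    an event. *)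
Lemma slot_value_bound t : 0 <= slot_value p r PD feedback A m t <= 1.
Proof.
have nmM : (0 + m <= m)%N by [].
have mX := @measurable_observed _ _ _ _ _ _ _ sys id 0 m.
pose X := @observed _ _ _ _ _ _ _ sys id 0 m.
rewrite /slot_value; under eq_bigr do rewrite -(pr_observed sys (@inj_id 'I_N) nmM rp pr2).
rewrite -(@pr_fin_valued _ _ _ _ _ X mX (fun x => config_state x t
  (run_action feedback A m (config_state x) (config_arrival x) t))).
rewrite pr_ge0 pr_le1//; exact: (measurable_fin_valued mX (fun x => config_state x t
  (run_action feedback A m (config_state x) (config_arrival x) t))).
Qed.

Lemma total_reward_bound : 0 <= total_reward sys feedback A <= m%:R.
Proof.
rewrite total_rewardE; apply/andP; split.
  by apply: sumr_ge0 => t _; case/andP: (slot_value_bound t).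
rewrite -[leRHS](_ : \sum_(1 <= t < m.+1) 1 = _); last first.
  by rewrite sumr_const_nat subn1.
by apply: ler_sum => t _; case/andP: (slot_value_bound t).
Qed.

End TotalReward.
End Reward.

(** * Convergence for superadditive sequences *)

Lemma fekete (R : realType) (u : nat -> R) :
  (forall m, 0 <= u m <= m%:R) ->
  (forall m n, u m + u n <= u (m + n)%N) ->
  exists c : R, (u m / m%:R) @[m --> \oo] --> c.
Proof.
(* The limit is the supremum of the ratios [u q / q] over positive [q]. *)
move=> u_bnd u_super; pose S := [set u q.+1 / q.+1%:R | q in setT].
have S_bnd q : 0 <= u q.+1 / q.+1%:R <= 1.
  have /andP[u0 u1] := u_bnd q.+1.
  by rewrite divr_ge0//= ler_pdivrMr ?mul1r ?ltr0n.
have S_sup : has_sup S.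
  split; first by exists (u 1%N / 1%:R), 0%N.
  by exists 1 => _ [q _ <-]; case/andP: (S_bnd q).
exists (sup S); apply/cvgrPdist_le => eps eps0.
have [_ [q _ <-]] := sup_adherent (divr_gt0 eps0 (ltr0n _ 2)) S_sup.
set a := u q.+1 / q.+1%:R => a_lt.
(* The incomplete block of length [j] is only credited with 0. *)
have u_mul k j : k%:R * u q.+1 <= u (k * q.+1 + j)%N.
  elim: k => [|k IH]; first by rewrite mul0r; case/andP: (u_bnd (0 * q.+1 + j)%N).
  rewrite -natr1 mulrDl mul1r mulSn -addnA addrC.
  by apply: le_trans (u_super _ _); rewrite lerD2l.
near=> m.
have m0 : (0 < m)%N by near: m; exact: nbhs_infty_gt.
have u_le : u m / m%:R <= sup S.
  by apply: ub_le_sup; [case: S_sup|exists m.-1 => //; rewrite prednK].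
(* For such [m] the incomplete block, shorter than [q.+1], costs at most [eps / 2] per slot. *)
have mge : q.+1%:R / (eps / 2) <= m%:R by near: m; exact: nbhs_infty_ger.
rewrite ger0_norm ?subr_ge0// lerBlDl -lerBlDr.
have mR0 : (0 : R) < m%:R by rewrite ltr0n.
rewrite ler_pdivlMr//.
have mE := divn_eq m q.+1; have rem := ltn_pmod m (ltn0Sn q).
have := u_mul (m %/ q.+1)%N (m %% q.+1)%N; rewrite -mE => um.
apply: le_trans um.
have aE : u q.+1 = a * q.+1%:R by rewrite /a divfK// pnatr_eq0.
have kq : m%:R - q.+1%:R <= (m %/ q.+1)%:R * q.+1%:R :> R.
  rewrite lerBlDr -natrM -natrD ler_nat {1}mE leq_add2l; exact: ltnW.
have /andP[a0 a1] := S_bnd q; rewrite -/a in a0 a1.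
have qm : q.+1%:R <= eps / 2 * m%:R.
  by rewrite -ler_pdivrMl ?divr_gt0// mulrC.
rewrite aE mulrCA.
apply: (@le_trans _ _ (a * (m%:R - q.+1%:R))); last by rewrite ler_wpM2l.
rewrite mulrBr.
have aq : a * q.+1%:R <= q.+1%:R by rewrite ger_pMl ?ltr0n.
have am : (sup S - eps / 2) * m%:R <= a * m%:R by rewrite ler_pM2r// ltW.
have -> : (sup S - eps) * m%:R =
  (sup S - eps / 2) * m%:R - eps / 2 * m%:R by field.
lra.
Unshelve. all: by end_near. Qed.

(** * Imitation, concatenation and existence of the maximal rate *)

Section Capacity.
Variables (R : realType) (p r : R) (PD : nat -> R).
Hypotheses (rp : r < p) (pr2 : p + (1 - r) < 2).

(** [A'] applies [A] to the translated information and renames its decision, so it only schedules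
    users in the image of [iota]. *)
Lemma total_reward_imitation (N N' : nat) (F F' : Type)
    (feedback : 'I_N -> ('I_N -> bool) -> F)
    (feedback' : 'I_N' -> ('I_N' -> bool) -> F')
    (iota : 'I_N -> 'I_N') (inv : 'I_N' -> 'I_N) (red : 'I_N' -> F' -> F) (m : nat)
    (sys : downlink p r PD (fun _ : 'I_N => stationary_on p r) m)
    (sys' : downlink p r PD (fun _ : 'I_N' => stationary_on p r) m)
    (A : policy N F) :
  cancel iota inv ->
  (forall a s, red (iota a) (feedback' (iota a) s) = feedback a (s \o iota)) ->
  exists A' : policy N' F',
    total_reward sys' feedback' A' = total_reward sys feedback A.
Proof.
move=> iotaK redf; exists (fun k l => iota (A k (map (translate 0 inv red) l))).
rewrite (total_reward_success rp pr2) (total_rewardE rp pr2).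
apply: eq_big_nat => t tm.
rewrite -[in LHS](addn0 t); apply: (@pr_slot_success _ _ _ _ rp pr2 N N' F F'
  feedback feedback' iota inv red 0 m 0) => //.
  by rewrite add0n addn0.
by move=> k l _; rewrite addn0 drop0.
Qed.

Section OneSystem.
Variables (N : nat) (sys : stationary_downlinks N p r PD).
Variables (F : Type) (feedback : 'I_N -> ('I_N -> bool) -> F).
Let reward m (A : policy N F) := total_reward (sys m) feedback A.

(* In the last [n] slots the information from the first [m] is discarded: the
   channels are then again in their stationary law. *)
Lemma total_reward_concat m n (A B : policy N F) :
  exists C : policy N F, reward (m + n) C = reward m A + reward n B.
Proof.
pose C : policy N F := fun k l =>
  if (n < k)%N then A (k - n)%N (map (translate n id (fun _ => id)) l)
  else B k (drop m l).
exists C; rewrite /reward (total_reward_success rp pr2) !(total_rewardE rp pr2).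
rewrite (@big_cat_nat _ _ _ n.+1)//=; last by rewrite ltnS leq_addl.
(* Slots are numbered downwards, so the slots above [n] come first in time and are played with [A];
   hence the swap. *)
rewrite addrC; congr (_ + _).
  rewrite -add1n big_addn -addSn addnK; apply: eq_big_nat => t tm.
  apply: (@pr_slot_success _ _ _ _ rp pr2 N N F F feedback feedback id id
    (fun _ => id) n m 0) => //; first by rewrite addn0 addnC.
  move=> k l /andP[k0 _]; rewrite /C drop0 addnK ifT//.
  by rewrite -[X in (X < _)%N]add0n ltn_add2r.
apply: eq_big_nat => t tm; rewrite -[in LHS](addn0 t).
apply: (@pr_slot_success _ _ _ _ rp pr2 N N F F feedback feedback id id
    (fun _ => id) 0 n m) => //; first by rewrite add0n addnC.
move=> k l /andP[_ kn]; rewrite /C addn0 ifF; last by rewrite ltnNge kn.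
by rewrite (eq_map (@translate_id _ _)) map_id.
Qed.

(* The first entry of the information carries the horizon. *)
Definition horizon (k : nat) (l : information N F) : nat :=
  if l is x :: _ then x.1.1 else k.

(** In the first slot the information is empty, but then the current slot is [m] itself; later the
    head of the list, whose slot is [m], never changes. *)
Lemma horizon_run (A : policy N F) m st arrival j :
  horizon (m - j) (map (run_observe feedback st arrival (m - j))
    (run_decisions feedback A m st arrival j)) = m.
Proof.
elim: j => [|j IH] /=; first by rewrite subn0.
move: (size_run_decisions feedback A m st arrival j) IH.
case: run_decisions => [/= <- _|[t a] s _ //]; first by rewrite subn0.
Qed.

(** A rate has to be achieved by one policy for all horizons; this merges one policy per horizon
    into a single one at no loss. *)
Lemma total_reward_horizon (A : nat -> policy N F) m :
  reward m (fun k l => A (horizon k l) k l) = reward m (A m).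
Proof.
rewrite /reward !(total_rewardE rp pr2); apply: eq_big_nat => t tm.
set C := fun k l => _.
have decE st arr j : run_decisions feedback C m st arr j =
    run_decisions feedback (A m) m st arr j.
  elim: j => //= j IH; rewrite IH; congr (rcons _ (_, _)).
  by rewrite /C horizon_run.
have actE st arr : run_action feedback C m st arr t =
    run_action feedback (A m) m st arr t.
  rewrite /run_action /run_info decE /C.
  by have := horizon_run (A m) m st arr (m - t); rewrite subKn => [->|]; last lia.
by apply: eq_bigl => x; rewrite actE.
Qed.

Hypothesis N0 : (0 < N)%N.

Definition value m : R := sup [set reward m A | A in setT].

Lemma has_sup_reward m : has_sup [set reward m A | A in setT].
Proof.
split; first by exists (reward m (fun _ _ => Ordinal N0)), (fun _ _ => Ordinal N0).
by exists m%:R => _ [A _ <-]; case/andP: (total_reward_bound rp pr2 (sys m) feedback A).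
Qed.

Lemma reward_le_value m A : reward m A <= value m.
Proof. by apply: ub_le_sup; [case: (has_sup_reward m)|exists A]. Qed.

Lemma value_superadditive m n : value m + value n <= value (m + n).
Proof.
apply/ler_addgt0Pr => e e0; have e2 : 0 < e / 2 by rewrite divr_gt0.
have [_ [A _ <-]] := sup_adherent e2 (has_sup_reward m).
have [_ [B _ <-]] := sup_adherent e2 (has_sup_reward n).
have [C CE] := total_reward_concat m n A B.
have := reward_le_value (m + n) C; rewrite CE /value; lra.
Qed.

Lemma value_bound m : 0 <= value m <= m%:R.
Proof.
apply/andP; split.
  apply: le_trans (reward_le_value m (fun _ _ => Ordinal N0)).
  by case/andP: (total_reward_bound rp pr2 (sys m) feedback (fun _ _ => Ordinal N0)).
apply: ge_sup; first by case: (has_sup_reward m).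
by move=> _ [A _ <-]; case/andP: (total_reward_bound rp pr2 (sys m) feedback A).
Qed.

(** At no horizon does a policy beat [value m], so the limit given by Fekete's lemma bounds every
    achievable rate; reading off the horizon achieves it. *)
Lemma is_max_rate_value : exists c : R,
  is_max_rate sys feedback c /\ (value m / m%:R) @[m --> \oo] --> c.
Proof.
have [c cvg_c] := fekete value_bound value_superadditive.
exists c; split=> //; split; last first.
  move=> c' [A cvg_c']; apply: (ler_cvg_to cvg_c' cvg_c).
  by apply: nearW => m; rewrite ler_wpM2r// ?invr_ge0// reward_le_value.
(* A slack of 1 in the total reward is enough, since it amounts to [1 / m] per slot. *)
have near_opt m : {A | value m - 1 <= reward m A}.
  apply: cid; have [_ [A _ <-]] := sup_adherent ltr01 (has_sup_reward m).
  by exists A; exact: ltW.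
exists (fun k l => sval (near_opt (horizon k l)) k l).
apply: (@squeeze_cvgr _ _ _ _ (fun m => value m / m%:R - m%:R^-1)
  (fun m => value m / m%:R)) => //; last first.
  rewrite -[c]subr0; apply: cvgB => //.
  rewrite -(cvg_shiftS (fun m => m%:R^-1 : R)); exact: cvg_harmonic.
apply: nearW => m.
have := total_reward_horizon (fun m => sval (near_opt m)) m.
rewrite /reward => ->.
rewrite [X in _ && X]ler_wpM2r ?invr_ge0// ?reward_le_value// andbT.
rewrite -[X in _ - X]mul1r -mulrBl ler_wpM2r ?invr_ge0//.
exact: (svalP (near_opt m)).
Qed.

End OneSystem.

Lemma value_imitation (N N' : nat) (F F' : Type)
    (feedback : 'I_N -> ('I_N -> bool) -> F)
    (feedback' : 'I_N' -> ('I_N' -> bool) -> F')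
    (iota : 'I_N -> 'I_N') (inv : 'I_N' -> 'I_N) (red : 'I_N' -> F' -> F)
    (sys : stationary_downlinks N p r PD) (sys' : stationary_downlinks N' p r PD)
    (m : nat) :
  (0 < N)%N -> (0 < N')%N -> cancel iota inv ->
  (forall a s, red (iota a) (feedback' (iota a) s) = feedback a (s \o iota)) ->
  value sys feedback m <= value sys' feedback' m.
Proof.
move=> N0 N'0 iotaK redf; apply: ge_sup; first by case: (has_sup_reward sys feedback N0 m).
move=> _ [A _ <-].
have [A' <-] := total_reward_imitation (feedback := feedback)
  (feedback' := feedback') (red := red) (sys m) (sys' m) A iotaK redf.
exact: reward_le_value.
Qed.

End Capacity.

(** * The two bounds on the sum capacity *)

Theorem corollary8 (R : realType) (N : nat) (p r : R) (PD : nat -> R)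
    (sys2 : stationary_downlinks 2 p r PD)
    (sysN : stationary_downlinks N p r PD) :
  0 <= p <= 1 -> 0 <= r <= 1 -> r < p -> p + (1 - r) < 2 ->
  is_pmf PD -> (2 < N)%N ->
  exists C2 CN CG : R,
    [/\ is_sum_capacity sys2 C2,
        is_sum_capacity sysN CN,
        is_genie_sum_capacity sysN CG
      & C2 <= CN <= CG].
Proof.
move=> _ _ rp pr2 _ N2; have N0 : (0 < N)%N by exact: leq_trans N2.
have [C2 [max2 cvg2]] := is_max_rate_value rp pr2 sys2 (@arq_feedback 2) isT.
have [CN [maxN cvgN]] := is_max_rate_value rp pr2 sysN (@arq_feedback N) N0.
have [CG [maxG cvgG]] := is_max_rate_value rp pr2 sysN (@genie_feedback N) N0.
exists C2, CN, CG; split=> //; apply/andP; split.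
  apply: (ler_cvg_to cvg2 cvgN); apply: nearW => m.
  rewrite ler_wpM2r ?invr_ge0//.
  (* The two users become the first two of the [N]; [inord] sends all others to a default,
     harmlessly, as the imitating policy never schedules them. *)
  have inordK2 : cancel (widen_ord (ltnW N2)) (fun a : 'I_N => inord a : 'I_2).
    by move=> a; apply/val_inj; rewrite /= inordK.
  by apply: (value_imitation (red := fun _ => id) rp pr2 _ _ _ (ltn0Sn 1) N0 inordK2).
apply: (ler_cvg_to cvgN cvgG); apply: nearW => m.
rewrite ler_wpM2r ?invr_ge0//.
(* The users are the same on both sides; the reduction keeps only the scheduled user's entry of the
   joint state. *)
have idK : cancel (@id 'I_N) id by [].
apply: (value_imitation (red := fun a (f : {ffun 'I_N -> bool}) => f a)
  rp pr2 _ _ _ N0 N0 idK).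
by move=> a s; rewrite /genie_feedback/= ffunE.
Qed.
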